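(* Let $X$ be a random matrix with values in $\mathcal{S}_d^{+}$ and let $A \in \mathcal{S}_d^{++}$ be a deterministic matrix. Then $$\mathbb{P}(X \succeq A) \leq \frac{\operatorname{tr}\left((\mathbb{E} X) A^{-1}\right)}{d}.$$
   Context: $\mathcal{S}_d$ denotes the set of $d\times d$ real symmetric matrices, $\mathcal{S}_d^{+}$ the positive semidefinite ones and $\mathcal{S}_d^{++}$ the positive definite ones. The Loewner order: for $A,B\in\mathcal{S}_d$, $A \preceq B$ (equivalently $B\succeq A$) means $B-A$ is positive semidefinite. Expectations of random matrices are taken entrywise and are assumed to exist when written. *)

(* Defs.v *)
From mathcomp Require Import all_boot all_order all_algebra.
From mathcomp Require Import all_classical all_reals all_analysis.
Set Implicit Arguments.
Unset Strict Implicit.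
Unset Printing Implicit Defensive.
Import Order.TTheory GRing.Theory Num.Theory.
Import numFieldNormedType.Exports.
Local Open Scope classical_set_scope.
Local Open Scope ring_scope.

Definition psdmx (R : realType) (d : nat) (A : 'M[R]_d) : Prop :=
  A \is symmetricmx /\ forall x : 'cV[R]_d, 0 <= (x^T *m A *m x) 0 0.

Definition pdmx (R : realType) (d : nat) (A : 'M[R]_d) : Prop :=
  A \is symmetricmx /\
  forall x : 'cV[R]_d, x != 0 -> 0 < (x^T *m A *m x) 0 0.

Definition loewner_le (R : realType) (d : nat) (A B : 'M[R]_d) : Prop :=
  psdmx (B - A).

(* 'M[R]_d carries no measurable structure in the library; measurability for
   its Borel sigma-algebra is measurability of every entry. *)
Definition random_mx (disp : measure_display) (T : measurableType disp)
    (R : realType) (d : nat) (X : T -> 'M[R]_d) : Prop :=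
  forall i j : 'I_d, measurable_fun [set: T] (fun w => X w i j).

Definition integrable_mx (disp : measure_display) (T : measurableType disp)
    (R : realType) (P : probability T R) (d : nat) (X : T -> 'M[R]_d) : Prop :=
  forall i j : 'I_d, P.-integrable [set: T] (fun w => (X w i j)%:E).

(* The expectations are extended reals; [fine] loses nothing under
   [integrable_mx]. *)
Definition expectation_mx (disp : measure_display) (T : measurableType disp)
    (R : realType) (P : probability T R) (d : nat) (X : T -> 'M[R]_d)
    : 'M[R]_d :=
  \matrix_(i < d, j < d) fine 'E_P[fun w => X w i j].

(* Main.v *)
(* The trace of a product of two positive semidefinite matrices is nonnegative.
   With B = A^-1 this gives tr (X A^-1) >= 0 always, and
   tr (X A^-1) >= tr (A A^-1) = d when X - A is positive semidefinite; so the
   indicator of the event is at most tr (X A^-1) / d, and it remains to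
   integrate. The event is measurable because semidefiniteness need only be
   tested on the countably many rational vectors. *)
Require Import Defs.
From mathcomp Require Import all_boot all_order all_algebra.
From mathcomp Require Import all_classical all_reals all_analysis.
From mathcomp Require Import measurable_realfun ring lra.
Set Implicit Arguments.
Unset Strict Implicit.
Unset Printing Implicit Defensive.
Import Order.TTheory GRing.Theory Num.Theory.
Import numFieldNormedType.Exports.
Local Open Scope classical_set_scope.
Local Open Scope ring_scope.

Lemma symmetricmxP (R : realType) (d : nat) (M : 'M[R]_d) :
  M \is symmetricmx <-> M^T = M.
Proof.
have e : map_mx idfun M^T = M^T by apply/matrixP => i j; rewrite !mxE.
split=> [/is_hermitianmxP|h].
  by rewrite expr0 scale1r e => <-.
by apply/is_hermitianmxP; rewrite expr0 scale1r e.
Qed.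

Definition mxform (R : realType) (d : nat) (M : 'M[R]_d) (x y : 'cV[R]_d) : R :=
  (x^T *m M *m y) 0 0.

Lemma mxformE (R : realType) (d : nat) (M : 'M[R]_d) (x y : 'cV[R]_d) :
  mxform M x y = \sum_i \sum_j x i 0 * M i j * y j 0.
Proof.
rewrite /mxform mxE exchange_big /=; apply: eq_bigr => j _.
by rewrite mxE mulr_suml; apply: eq_bigr => i _; rewrite mxE.
Qed.

Lemma mxform_delta (R : realType) (d : nat) (M : 'M[R]_d) (i j : 'I_d) :
  mxform M (delta_mx i 0) (delta_mx j 0) = M i j.
Proof. by rewrite /mxform trmx_delta -rowE -colE !mxE. Qed.

Lemma mxformC (R : realType) (d : nat) (M : 'M[R]_d) (x y : 'cV[R]_d) :
  M^T = M -> mxform M x y = mxform M y x.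
Proof.
move=> sM; rewrite /mxform -[in LHS](trmxK (x^T *m M *m y)) mxE.
by rewrite !trmx_mul trmxK sM mulmxA.
Qed.

Lemma mxform_lincomb (R : realType) (d : nat) (M : 'M[R]_d) (x y : 'cV[R]_d)
    (a b : R) : M^T = M ->
  mxform M (a *: x + b *: y) (a *: x + b *: y) =
  a ^+ 2 * mxform M x x + 2 * a * b * mxform M x y + b ^+ 2 * mxform M y y.
Proof.
move=> sM; have := mxformC x y sM; rewrite /mxform => e.
rewrite [_^T]linearD /= ![(_ *: _)^T]linearZ /= !mulmxDl !mulmxDr.
rewrite -!scalemxAl -!scalemxAr.
move: e; rewrite !mxE /= => e.
rewrite -e; ring.
Qed.

(** On the combinations [a *: x + b *: y] the form is a nonnegative quadratic in [a] and [b];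
    suitable coefficients yield the bound. No definiteness is available, so a vanishing
    [mxform M y y] is treated apart. *)
Lemma psdmx_Cauchy_Schwarz (R : realType) (d : nat) (M : 'M[R]_d)
    (x y : 'cV[R]_d) : psdmx M ->
  mxform M x y ^+ 2 <= mxform M x x * mxform M y y.
Proof.
case=> /symmetricmxP sM M0.
have h a b := M0 (a *: x + b *: y).
have {h}h a b : 0 <= a ^+ 2 * mxform M x x + 2 * a * b * mxform M x y
    + b ^+ 2 * mxform M y y by rewrite -mxform_lincomb //; exact: h.
have x0 : 0 <= mxform M x x := M0 x.
have y0 : 0 <= mxform M y y := M0 y.
move: (mxform M x x) (mxform M x y) (mxform M y y) h x0 y0 => p q r h p0 r0.
have [r_gt0|] := ltP 0 r.
  (* The pair [(r, - q)] minimises the quadratic up to scale; its value there is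
     [r * (p * r - q ^+ 2)]. *)
  have := h r (- q).
  have -> : r ^+ 2 * p + 2 * r * - q * q + (- q) ^+ 2 * r = r * (p * r - q ^+ 2)
    by ring.
  by rewrite pmulr_rge0 // subr_ge0.
move=> r_le0; have {r_le0 r0} r0 : r = 0 by apply/le_anti/andP.
(* With [r = 0] this choice makes the quadratic equal to [- q ^+ 2], which forces [q = 0]. *)
have := h q (- (p + 1) / 2); rewrite r0; nra.
Qed.

(* One step of Cholesky elimination: subtracting a rank-one matrix kills the
   i-th diagonal entry, and Cauchy-Schwarz keeps the rest semidefinite. *)
Lemma psdmx_elim (R : realType) (d : nat) (M : 'M[R]_d) (i : 'I_d) :
  psdmx M -> 0 < M i i ->
  psdmx (M - (M i i)^-1 *: (col i M *m (col i M)^T)).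
Proof.
move=> pM Mi; have [/symmetricmxP sM M0] := pM; split.
  apply/symmetricmxP.
  by rewrite linearB linearZ /= trmx_mul trmxK sM.
move=> x; rewrite mulmxBr mulmxBl -scalemxAr -scalemxAl.
have e : (x^T *m (col i M *m (col i M)^T) *m x) 0 0 =
    mxform M x (delta_mx i 0) ^+ 2.
  rewrite colE expr2; set v := M *m _.
  have -> : x^T *m (v *m v^T) *m x = (x^T *m v) *m (v^T *m x).
    by rewrite !mulmxA.
  rewrite [LHS]mxE big_ord1; congr (_ * _); first by rewrite /v mulmxA.
  by rewrite (mxformC _ _ sM) /mxform /v trmx_mul sM.
rewrite [X in 0 <= X]mxE [X in _ + X]mxE [X in - X]mxE e subr_ge0 mulrC.
rewrite ler_pdivrMr //; have := psdmx_Cauchy_Schwarz x (delta_mx i 0) pM.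
by rewrite mxform_delta.
Qed.

(** Induction on a bound for the number of nonzero diagonal entries of [M]. Each elimination step
    splits off a term [c *: (v *m v^T)], which contributes [c] times the value of the form of [B] at
    [v]. *)
Lemma mxtrace_psdmx_mul_ge0 (R : realType) (d : nat) (M B : 'M[R]_d) :
  psdmx M -> psdmx B -> 0 <= \tr (M *m B).
Proof.
have [n] := ubnPleq #|[set i | M i i != 0]%SET|.
move=> + + pB; elim: n M => [|n IH] M hn pM.
  have [_ M0] := pM.
  have Mii i : M i i = 0.
    apply/eqP; apply: contraTT hn => Mi; rewrite -ltnNge; apply/card_gt0P.
    by exists i; rewrite inE.
  suff -> : M = 0 by rewrite mul0mx mxtrace0.
  apply/matrixP => i j.
  (* Cauchy-Schwarz on basis vectors bounds the square of [M i j] by [M i i * M j j], so a zero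
     diagonal leaves only the zero matrix. *)
  have := psdmx_Cauchy_Schwarz (delta_mx i 0) (delta_mx j 0) pM.
  rewrite !mxform_delta !Mii mul0r mxE => h.
  by apply/eqP; rewrite -sqrf_eq0 eq_le h sqr_ge0.
have diag_ge0 (N : 'M[R]_d) : psdmx N -> forall i, 0 <= N i i.
  by move=> [_ N0] i; rewrite -mxform_delta; exact: N0.
have [[i]|/existsPn h] := altP (@existsP _ (fun i => M i i != 0)); last first.
  apply: IH => //; rewrite eq_card0 //.
  by move=> i; rewrite inE; apply/negbTE/h.
move=> Mi_neq0.
have Mi : 0 < M i i by rewrite lt_neqAle eq_sym Mi_neq0 diag_ge0.
have pM' := psdmx_elim pM Mi.
set v := col i M in pM'; set c := (M i i)^-1 in pM'.
have -> : M = (M - c *: (v *m v^T)) + c *: (v *m v^T) by rewrite subrK.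
rewrite mulmxDl mxtraceD addr_ge0 //; last first.
  rewrite -scalemxAl mxtraceZ mulr_ge0 // ?invr_ge0 ?(ltW Mi) //.
  by rewrite -mulmxA mxtrace_mulC trace_mx11; exact: (pB.2).
apply: IH => //.
have vE k : v k 0 = M k i by rewrite mxE.
have M'E k : (M - c *: (v *m v^T)) k k = M k k - c * M k i ^+ 2.
  by rewrite !mxE big_ord1 [v^T _ _]mxE vE expr2.
(* The count drops strictly: index [i] leaves the set, and no index enters it. *)
rewrite -ltnS; apply: leq_trans hn; apply: proper_card.
apply/properP; split; last first.
  exists i; rewrite inE ?Mi_neq0 // M'E /c.
  by rewrite expr2 mulrA mulVf // mul1r subrr eqxx.
apply/fintype.subsetP => k; rewrite !inE; apply: contra => /eqP Mk.
(* A zero diagonal entry turns into [- (c * M k i ^+ 2)], which semidefiniteness keeps nonnegative;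
   hence it stays zero. *)
have := diag_ge0 _ pM' k; rewrite M'E Mk sub0r oppr_ge0 => h.
rewrite oppr_eq0 eq_le h mulr_ge0 ?sqr_ge0 //.
by rewrite invr_ge0 ltW.
Qed.

Lemma pdmx_unitmx (R : realType) (d : nat) (A : 'M[R]_d) :
  pdmx A -> A \in unitmx.
Proof.
case=> _ A0; rewrite unitmxE unitfE; apply/negP => /det0P [v v0 vA].
have := A0 v^T; rewrite trmxK vA mul0mx mxE ltxx => h.
suff : v^T != 0 by move/h.
by apply: contra v0 => /eqP e; rewrite -[v]trmxK e trmx0.
Qed.

(** The form of the inverse at [x] is the form of [A] at [invmx A *m x]. *)
Lemma pdmx_inv_psdmx (R : realType) (d : nat) (A : 'M[R]_d) :
  pdmx A -> psdmx (invmx A).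
Proof.
move=> pA; have uA := pdmx_unitmx pA; case: pA => /symmetricmxP sA A0.
have sV : (invmx A)^T = invmx A by rewrite trmx_inv sA.
split; first exact/symmetricmxP.
move=> x; have -> : x^T *m invmx A *m x =
    (invmx A *m x)^T *m A *m (invmx A *m x).
  by rewrite trmx_mul sV !mulmxA mulmxKV.
have [->|] := eqVneq (invmx A *m x) 0; last by move/A0/ltW.
by rewrite mulmx0 mxE.
Qed.

Lemma mxform_ge0_rat (R : realType) (d : nat) (M : 'M[R]_d) :
  (forall q : 'cV[rat]_d, 0 <= mxform M (map_mx ratr q) (map_mx ratr q)) ->
  forall x, 0 <= mxform M x x.
Proof.
move=> M0 x.
(* Each coordinate is approximated from above by a rational within [1 / (n + 1)]; the form, a
   polynomial in the coordinates, passes to the limit. *)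
have /choice[u ux] : forall ni : nat * 'I_d, exists q : rat,
    ratr q \in `]x ni.2 0, (x ni.2 0 + harmonic ni.1)[.
  by move=> ni; apply: rat_in_itvoo; rewrite ltrDl /= invr_gt0.
pose v n : 'cV[R]_d := map_mx ratr (\col_i u (n, i)).
have vx i : v n i 0 @[n --> \oo] --> x i 0.
  apply: (@squeeze_cvgr _ _ _ _ (cst (x i 0)) (fun n => x i 0 + harmonic n)).
  - apply: nearW => n; rewrite !mxE.
    by have := ux (n, i); rewrite in_itv /= => /andP[/ltW -> /ltW ->].
  - exact: cvg_cst.
  - rewrite -[X in _ --> X]addr0.
    by apply: cvgD; [exact: cvg_cst | exact: cvg_harmonic].
have : mxform M (v n) (v n) @[n --> \oo] --> mxform M x x.
  rewrite mxformE; under eq_cvg do rewrite mxformE.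
  apply: cvg_big => [|i _]; first exact: add_continuous.
  apply: cvg_big => [|j _]; first exact: add_continuous.
  by apply: cvgM; [apply: cvgM; [exact: vx | exact: cvg_cst] | exact: vx].
by move/cvgr_to_ge; apply; apply: nearW => n; exact: M0.
Qed.

Lemma measurable_psdmx (R : realType) (disp : measure_display)
    (T : measurableType disp) (d : nat) (Y : T -> 'M[R]_d) :
  random_mx Y -> (forall w, (Y w)^T = Y w) ->
  measurable [set w | psdmx (Y w)].
Proof.
move=> mY sY.
(* Rational vectors are enumerated through their codes; a number coding no vector imposes no
   condition, hence [setT]. *)
pose F n := if unpickle n is Some q then
  [set w | 0 <= mxform (Y w) (map_mx ratr (q : 'cV[rat]_d)) (map_mx ratr q)]
  else setT.
have -> : [set w | psdmx (Y w)] = \bigcap_n F n.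
  apply/seteqP; split=> [w [_ Y0] n _ | w Fw].
    by rewrite /F; case: unpickle => [q|//]; exact: Y0.
  split; first exact/symmetricmxP.
  apply: mxform_ge0_rat => q.
  by have := Fw (pickle q) I; rewrite /F pickleK.
apply: bigcapT_measurable => n; rewrite /F; case: unpickle => [q|//].
rewrite -[X in measurable X]setTI.
apply: measurable_fun_le => //.
under eq_fun do rewrite mxformE.
apply: measurable_sum => i; apply: measurable_sum => j.
by do 2! apply: measurable_funM => //; exact: mY.
Qed.

(** The trace is a finite linear combination of the entries of [X w] with constant coefficients, so
    expectation passes through it. *)
Lemma integrable_mxtrace_mul (R : realType) (disp : measure_display)
    (T : measurableType disp) (P : probability T R) (d : nat)
    (X : T -> 'M[R]_d) (B : 'M[R]_d) : integrable_mx P X ->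
  P.-integrable setT (fun w => (\tr (X w *m B))%:E) /\
  (\int[P]_w (\tr (X w *m B))%:E = (\tr (expectation_mx P X *m B))%:E)%E.
Proof.
move=> iX.
have iXB i j : P.-integrable setT (fun w => (X w i j)%:E * (B j i)%:E)%E.
  by apply: integrableZr => //; exact: iX.
have trE (N : 'M[R]_d) :
    ((\tr (N *m B))%:E = \sum_i \sum_j (N i j)%:E * (B j i)%:E)%E.
  rewrite -sumEFin; apply: eq_bigr => i _; rewrite mxE -sumEFin.
  by apply: eq_bigr => j _; rewrite EFinM.
split.
  under eq_fun do rewrite trE.
  by apply: integrable_sum => // i _; apply: integrable_sum.
under eq_integral do rewrite trE.
rewrite integral_sum //; last by move=> i; apply: integrable_sum.
rewrite trE; apply: eq_bigr => i _; rewrite integral_sum //.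
apply: eq_bigr => j _; rewrite (integralZr measurableT (iX i j)).
by rewrite mxE unlock fineK //; exact: integrable_fin_num (iX i j).
Qed.

Unset Implicit Arguments.
Set Strict Implicit.

Theorem theorem2p1 (R : realType) (disp : measure_display)
    (T : measurableType disp) (P : probability T R) (d : nat) (hd : (0 < d)%N)
    (X : T -> 'M[R]_d) (A : 'M[R]_d)
    (X_random : random_mx X)
    (X_psd : forall w : T, psdmx (X w))
    (X_int : integrable_mx P X)
    (A_pd : pdmx A) :
  (P [set w | loewner_le A (X w)]
     <= (\tr (expectation_mx P X *m invmx A) / d%:R)%:E)%E.
Proof.
have uA := pdmx_unitmx A_pd; have pV := pdmx_inv_psdmx A_pd.
set E := [set w | _].
have mE : measurable E.
  apply: measurable_psdmx => [i j|w].
    under eq_fun do rewrite !mxE.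
    by apply: measurable_funB => //; exact: X_random.
  have [/symmetricmxP sX _] := X_psd w; case: A_pd => /symmetricmxP sA _.
  by rewrite linearB /= sX sA.
(* The factor [1 / d] is absorbed into the constant matrix, so that the bound becomes the integral
   of a single trace. *)
have [iX <-] : P.-integrable setT
    (fun w => (\tr (X w *m (d%:R^-1 *: invmx A)))%:E) /\
  (\int[P]_w (\tr (X w *m (d%:R^-1 *: invmx A)))%:E =
    (\tr (expectation_mx P X *m invmx A) / d%:R)%:E)%E.
  have [? ->] := integrable_mxtrace_mul (d%:R^-1 *: invmx A) X_int.
  by split=> //; rewrite -scalemxAr mxtraceZ mulrC.
have -> : P E = (\int[P]_w (\1_E w)%:E)%E by rewrite integral_indic // setIT.
apply: ge0_le_integral => //.
- exact/measurable_EFinP/measurable_indic.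
- exact: measurable_int iX.
move=> w _; rewrite lee_fin indicE -scalemxAr mxtraceZ.
have [/set_mem Ew|_] /= := boolP (w \in E); last first.
  by rewrite mulr_ge0 ?invr_ge0 // mxtrace_psdmx_mul_ge0.
(* On the event, [hd] allows clearing the denominator: what remains is that [d] is at most the trace
   of [X w *m invmx A]. *)
rewrite mulrC ler_pdivlMr ?ltr0n // mul1r.
have := mxtrace_psdmx_mul_ge0 Ew pV.
by rewrite mulmxBl mulmxV // linearB /= mxtrace1 subr_ge0.
Qed.
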